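(* Let $(U,\{e_i\}_{i\in I})$ and $(T,\{f_j\}_{j\in J})$ be basic $\mathbb{K}$-algebras with enough idempotents, let $M$ be a $U$-$T$-bimodule on which $\mathbb{K}$ acts centrally such that $e_iMf_j$ is a $\mathbb{K}$-module of finite length for all $(i,j)\in I\times J$, and let $\Lambda:=\begin{bmatrix}T&0\\ M&U\end{bmatrix}$ be the lower triangular matrix $\mathbb{K}$-algebra with its idempotents $\{g_r\}_{r\in I\vee J}$. Then the following statements are equivalent. (a) $(\Lambda,\{g_r\}_{r\in I\vee J})$ is support finite. (b) $(U,\{e_i\}_{i\in I})$ and $(T,\{f_j\}_{j\in J})$ are support finite, $Mf_j\in\mathrm{mod}(U)$ for all $j\in J$, and $e_iM\in\mathrm{mod}(T^{op})$ for all $i\in I$. (c) $(U,\{e_i\}_{i\in I})$ and $(T,\{f_j\}_{j\in J})$ are support finite, and the sets $\mathrm{Supp}(Mf_j)$ and $\mathrm{Supp}(e_iM)$ are finite for all $i\in I$, $j\in J$. Moreover, if one of these equivalent conditions holds, then $U$, $T$ and $\Lambda$ are locally bounded.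
   Context: $\mathbb{K}$ is a fixed commutative ring with unity. Rings and algebras are associative but need not have a unity. A $\mathbb{K}$-algebra with enough idempotents (w.e.i. $\mathbb{K}$-algebra) is a pair $(R,\{e_i\}_{i\in I})$ with $R$ a $\mathbb{K}$-algebra and $\{e_i\}_{i\in I}$ a family of orthogonal idempotents of $R$ such that $R=\bigoplus_{i\in I}e_iR=\bigoplus_{i\in I}Re_i$. $\mathrm{Mod}(R)$ is the category of unitary left $R$-modules ($N$ with $RN=N$), $\mathrm{mod}(R)$ its full subcategory of finitely generated modules; $R^{op}$ is the opposite algebra, so $\mathrm{mod}(R^{op})$ consists of finitely generated unitary right $R$-modules. The algebra is basic if every $e_jRe_i$ is a $\mathbb{K}$-module of finite length, each $e_i$ is primitive, and $Re_i\not\simeq Re_j$ for $e_i\neq e_j$. Bimodules are unitary: $UM=M=MT$. The index sets $I,J$ are nonempty. Triangular algebra: $\Lambda$ consists of the matrices $\begin{bmatrix}t&0\\ m&u\end{bmatrix}$ ($t\in T$, $m\in M$, $u\in U$) with entrywise sum and product $\begin{bmatrix}t&0\\ m&u\end{bmatrix}\begin{bmatrix}t'&0\\ m'&u'\end{bmatrix}=\begin{bmatrix}tt'&0\\ mt'+um'&uu'\end{bmatrix}$. With $I\vee J=(I\times\{1\})\cup(J\times\{2\})$, set $g_{(i,1)}=\begin{bmatrix}0&0\\0&e_i\end{bmatrix}$ and $g_{(j,2)}=\begin{bmatrix}f_j&0\\0&0\end{bmatrix}$. Under the stated hypotheses $(\Lambda,\{g_r\}_{r\in I\vee J})$ is a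 basic w.e.i. $\mathbb{K}$-algebra. For a left $R$-module $N$, $\mathrm{Supp}(N)=\{k\in I: e_kN\neq0\}$; for a right module, $\mathrm{Supp}(N)=\{k: Ne_k\neq0\}$. Thus $\mathrm{Supp}(Mf_j)=\{i\in I:e_iMf_j\neq0\}$ and $\mathrm{Supp}(e_iM)=\{j\in J:e_iMf_j\neq0\}$. $(R,\{e_i\}_{i\in I})$ (each $e_i$ primitive) is support finite if $\mathrm{Supp}(Re_i)$ and $\mathrm{Supp}(e_iR)$ are finite for each $i$. It is locally bounded if each $e_i$ is primitive, $R$ is support finite, and $R$ is locally endofinite, i.e. all left modules $Re_i$ and all right modules $e_iR$ are endofinite, where a module $N$ is endofinite if each $e_kN$ (resp. $Ne_k$ for right modules) has finite length as a module over the endomorphism ring of $N$. *)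

(* Defs.v *)
From mathcomp Require Import all_boot all_order all_algebra.
From mathcomp Require Import boolp classical_sets functions cardinality fsbigop.

Set Implicit Arguments.
Unset Strict Implicit.
Unset Printing Implicit Defensive.

Import GRing.Theory.
Local Open Scope classical_set_scope.
Local Open Scope ring_scope.

(* MathComp rings are unital, so associative algebras without unity, and the
   modules over them, are introduced as records on top of lmodType/zmodType.
   Records rather than canonical structures: the same carrier is used both as a
   left and as a right module, and as an algebra and its opposite. *)
Record nualg (K : comPzRingType) := NuAlg {
  nualg_sort :> lmodType K;
  amul : nualg_sort -> nualg_sort -> nualg_sort;
  amulA : forall x y z, amul x (amul y z) = amul (amul x y) z;
  amulDl : forall x y z, amul (x + y) z = amul x z + amul y z;
  amulDr : forall x y z, amul x (y + z) = amul x y + amul x z;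
  ascaleAl : forall k x y, k *: amul x y = amul (k *: x) y;
  ascaleAr : forall k x y, k *: amul x y = amul x (k *: y) }.

Notation "x ** y" := (amul x y) (at level 40, left associativity) : ring_scope.

Definition nualg_op (K : comPzRingType) (R : nualg K) : nualg K :=
  NuAlg (amul := fun x y : R => y ** x)
    (fun x y z => esym (amulA z y x)) (fun x y z => amulDr z x y)
    (fun x y z => amulDl y z x) (fun k x y => ascaleAr k y x)
    (fun k x y => ascaleAl k y x).

(* Modules, not necessarily unitary.  Right R-modules are left modules over
   nualg_op R. *)
Record leftmod (K : comPzRingType) (R : nualg K) := LeftMod {
  leftmod_sort :> zmodType;
  act : R -> leftmod_sort -> leftmod_sort;
  actA : forall r s x, act (r ** s) x = act r (act s x);
  actDl : forall r s x, act (r + s) x = act r x + act s x;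
  actDr : forall r x y, act r (x + y) = act r x + act r y }.

Definition regular (K : comPzRingType) (R : nualg K) : leftmod R :=
  LeftMod (act := fun r x : R => r ** x)
    (fun r s x => esym (amulA r s x)) (@amulDl K R) (@amulDr K R).

Section Submodules.
Variables (K : comPzRingType) (R : nualg K) (V : leftmod R).
Implicit Type N : set V.

(* The modules occurring below (R e_i, M f_j, ...) are submodules of an ambient
   module V, and are represented by subsets N of V. *)
Definition submodule N : Prop :=
  [/\ N 0, forall x y, N x -> N y -> N (x - y)
    & forall r x, N x -> N (act r x)].

Definition unitary N : Prop :=
  forall x, N x -> exists s : seq (R * V),
    (forall p, p \in s -> N p.2) /\ x = \sum_(p <- s) act p.1 p.2.

Definition finitely_generated N : Prop :=
  exists s : seq V, (forall x, x \in s -> N x) /\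
    (forall N', submodule N' -> (forall x, x \in s -> N' x) -> N `<=` N').

(* N is an object of mod(R). *)
Definition fg_unitary_module N : Prop :=
  [/\ submodule N, unitary N & finitely_generated N].

End Submodules.

(* Module homomorphisms between submodules N of V and N' of V' are functions
   V -> V' whose values outside N are irrelevant. *)
Definition module_hom (K : comPzRingType) (R : nualg K) (V V' : leftmod R)
    (N : set V) (N' : set V') (f : V -> V') : Prop :=
  [/\ forall x, N x -> N' (f x),
      forall x y, N x -> N y -> f (x + y) = f x + f y
    & forall r x, N x -> f (act r x) = act r (f x)].

Definition module_iso (K : comPzRingType) (R : nualg K) (V V' : leftmod R)
    (N : set V) (N' : set V') : Prop :=
  exists2 f : V -> V', module_hom N N' f & set_bij N N' f.

(* The strict chains c 0 < ... < c n of submodules of N have bounded length n;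
   sub is the predicate "is a submodule" for the module structure under
   consideration. *)
Definition finite_length (V : Type) (sub : set V -> Prop) (N : set V) : Prop :=
  exists b : nat, forall (n : nat) (c : nat -> set V),
    (forall i, (i <= n)%N -> sub (c i) /\ c i `<=` N) ->
    (forall i, (i < n)%N -> c i `<` c i.+1) ->
    (n <= b)%N.

Definition ksubmodule (K : comPzRingType) (V : lmodType K) (A : set V) : Prop :=
  A 0 /\ forall (k : K) x y, A x -> A y -> A (k *: x + y).

Definition kfinite_length (K : comPzRingType) (V : lmodType K) (A : set V) :=
  finite_length (@ksubmodule K V) A.

(* Submodules, for the left action of the endomorphism ring of N. *)
Definition end_submodule (K : comPzRingType) (R : nualg K) (V : leftmod R)
    (N : set V) (A : set V) : Prop :=
  [/\ A 0, forall x y, A x -> A y -> A (x - y), A `<=` N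
    & forall f, module_hom N N f -> forall x, A x -> A (f x)].

(* V is the internal direct sum of the S i. *)
Definition direct_sum (V : zmodType) (I : choiceType) (S : I -> set V) : Prop :=
  forall x : V, exists! y : I -> V,
    [/\ forall i, S i (y i), finite_set [set i | y i <> 0]
      & x = \sum_(i \in [set: I]) y i].

(* K-algebras with enough idempotents (w.e.i.). *)
Record weialg (K : comPzRingType) (I : choiceType) := WeiAlg {
  wei_nualg :> nualg K;
  idem : I -> wei_nualg;
  idem_idem : forall i, idem i ** idem i = idem i;
  idem_orth : forall i j, i != j -> idem i ** idem j = 0;
  idem_sumr : direct_sum (fun i => range (fun x => idem i ** x));
  idem_suml : direct_sum (fun i => range (fun x => x ** idem i)) }.

Arguments idem {K I} w i.
Arguments idem_sumr {K I} w.
Arguments idem_suml {K I} w.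

Lemma idem_orth_op (K : comPzRingType) (I : choiceType) (R : weialg K I) i j :
  i != j -> idem R j ** idem R i = 0.
Proof. by move=> ij; apply: idem_orth; rewrite eq_sym. Qed.

Definition weialg_op (K : comPzRingType) (I : choiceType) (R : weialg K I) :
    weialg K I :=
  @WeiAlg K I (nualg_op R) (idem R) (@idem_idem K I R) (@idem_orth_op K I R)
    (@idem_suml K I R) (@idem_sumr K I R).

Definition primitive_idem (K : comPzRingType) (R : nualg K) (e : R) : Prop :=
  [/\ e ** e = e, e <> 0
    & forall a b : R, a ** a = a -> b ** b = b -> a ** b = 0 -> b ** a = 0 ->
        e = a + b -> a = 0 \/ b = 0].

Section WeiAlgebras.
Variables (K : comPzRingType) (I : choiceType).
Implicit Type R : weialg K I.

(* R e_i; since multiplication is reversed in weialg_op R, the right module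
   e_i R is left_proj (weialg_op R) i. *)
Definition left_proj R i : set (regular R) :=
  range (fun x : R => x ** idem R i).
Arguments left_proj R i : clear implicits.

Definition cut R (V : leftmod R) (k : I) (N : set V) : set V :=
  act (idem R k) @` N.

Definition supp R (V : leftmod R) (N : set V) : set I :=
  [set k | cut k N <> [set 0]].

Definition endofinite R (V : leftmod R) (N : set V) : Prop :=
  forall k, finite_length (end_submodule N) (cut k N).

Definition basic R : Prop :=
  [/\ forall i j, kfinite_length
        (range (fun x : R => idem R j ** x ** idem R i)),
      forall i, primitive_idem (idem R i)
    & forall i j, idem R i <> idem R j ->
        ~ module_iso (left_proj R i) (left_proj R j)].

(* Meant for algebras whose idem R i are all primitive. *)
Definition support_finite R : Prop :=
  forall i, finite_set (supp (left_proj R i)) /\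
            finite_set (supp (left_proj (weialg_op R) i)).

Definition locally_endofinite R : Prop :=
  forall i, endofinite (left_proj R i) /\
            endofinite (left_proj (weialg_op R) i).

Definition locally_bounded R : Prop :=
  [/\ forall i, primitive_idem (idem R i), support_finite R
    & locally_endofinite R].

End WeiAlgebras.

Arguments left_proj {K I} R i.

(* U-T-bimodules with a central action of K. *)
Record bimod (K : comPzRingType) (U T : nualg K) := Bimod {
  bimod_sort :> lmodType K;
  lact : U -> bimod_sort -> bimod_sort;
  ract : bimod_sort -> T -> bimod_sort;
  lactA : forall u v m, lact (u ** v) m = lact u (lact v m);
  lactDl : forall u v m, lact (u + v) m = lact u m + lact v m;
  lactDr : forall u m n, lact u (m + n) = lact u m + lact u n;
  lactZl : forall k u m, lact (k *: u) m = k *: lact u m;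
  lactZr : forall k u m, lact u (k *: m) = k *: lact u m;
  ractA : forall m s t, ract m (s ** t) = ract (ract m s) t;
  ractDl : forall m n t, ract (m + n) t = ract m t + ract n t;
  ractDr : forall m s t, ract m (s + t) = ract m s + ract m t;
  ractZl : forall k m t, ract (k *: m) t = k *: ract m t;
  ractZr : forall k m t, ract m (k *: t) = k *: ract m t;
  lractA : forall u m t, ract (lact u m) t = lact u (ract m t) }.

Definition left_of (K : comPzRingType) (U T : nualg K) (M : bimod U T) :
    leftmod U :=
  LeftMod (act := @lact K U T M) (@lactA K U T M) (@lactDl K U T M)
    (@lactDr K U T M).

Definition right_of (K : comPzRingType) (U T : nualg K) (M : bimod U T) :
    leftmod (nualg_op T) :=
  @LeftMod K (nualg_op T) M (fun t m => ract m t)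
    (fun s t m => ractA m t s) (fun s t m => ractDr m s t)
    (fun t m n => ractDl m n t).

Record ubimod (K : comPzRingType) (U T : nualg K) := UBimod {
  ubimod_bimod :> bimod U T;
  unitary_left : unitary [set: left_of ubimod_bimod];
  unitary_right : unitary [set: right_of ubimod_bimod] }.

Section Pieces.
Variables (K : comPzRingType) (I J : choiceType).
Variables (U : weialg K I) (T : weialg K J) (M : ubimod U T).

(* M f_j, e_i M and e_i M f_j *)
Definition bimod_f (j : J) : set (left_of M) :=
  range (fun m : M => ract m (idem T j)).
Definition e_bimod (i : I) : set (@right_of K U T M) :=
  range (fun m : M => lact (idem U i) m).
Definition e_bimod_f (i : I) (j : J) : set M :=
  range (fun m : M => ract (lact (idem U i) m) (idem T j)).

End Pieces.

Arguments bimod_f {K I J U T} M j.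
Arguments e_bimod {K I J U T} M i.
Arguments e_bimod_f {K I J U T} M i j.

Lemma morphD_sum (V W : zmodType) (f : V -> W) (A : Type) (r : seq A) (F : A -> V) :
  {morph f : x y / x + y} ->
  f (\sum_(a <- r) F a) = \sum_(a <- r) f (F a).
Proof.
move=> fD; apply: (big_morph f fD).
by apply: (@addrI _ (f 0)); rewrite -fD !addr0.
Qed.

Lemma fsum_seq (V : zmodType) (I : choiceType) (y : I -> V) (r : seq I) :
  uniq r -> (forall i, i \notin r -> y i = 0) ->
  \sum_(i \in [set: I]) y i = \sum_(i <- r) y i.
Proof.
move=> ur yr; rewrite (fsbigE r)//; first by apply: eq_bigl => i; rewrite in_setT.
by move=> i _ /yr.
Qed.

Lemma finite_support_seq (V : zmodType) (I : choiceType) (y : I -> V) :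
  finite_set [set i | y i <> 0] ->
  exists2 r : seq I, uniq r & forall i, i \notin r -> y i = 0.
Proof.
move=> /finite_seqP[t tE].
exists (undup t); rewrite ?undup_uniq// => i; rewrite mem_undup => it.
apply: contrapT => yi; move: it => /negP; apply.
by have : [set i | y i <> 0] i by []; rewrite tE.
Qed.

Section DirectSumIdempotents.
Variables (V : zmodType) (I : choiceType) (p : I -> V -> V).
Hypothesis pD : forall i, {morph p i : x y / x + y}.
Hypothesis pp : forall i x, p i (p i x) = p i x.
Hypothesis p_orth : forall i j x, i != j -> p i (p j x) = 0.

Let p_sum A (r : seq A) (F : A -> V) i :
  p i (\sum_(a <- r) F a) = \sum_(a <- r) p i (F a).
Proof. exact: morphD_sum. Qed.

Lemma direct_sum_span :
  (forall x, exists s : seq (I * V), x = \sum_(q <- s) p q.1 q.2) ->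
  direct_sum (fun i => range (p i)).
Proof.
move=> span x; have [s xE] := span x.
pose r := undup (map fst s).
have pr i : i \notin r -> p i x = 0.
  move=> ir; rewrite xE p_sum big_seq big1// => q qs; apply: p_orth.
  apply: contraNneq ir => ->; rewrite mem_undup; exact: map_f.
exists (fun i => p i x); split.
  split=> [i||].
  - by exists x.
  - apply: (sub_finite_set (B := [set` r])); last exact: finite_seq.
    move=> i /= yi; apply: contrapT => ir; apply: yi; apply: pr.
    by apply/negP.
  - rewrite (fsum_seq (undup_uniq _) pr).
    rewrite {1}xE (eq_bigr (fun i => \sum_(q <- s) p i (p q.1 q.2))); last first.
      by move=> i _; rewrite xE p_sum.
    rewrite exchange_big/=; apply: eq_big_seq => q qs.
    rewrite (bigD1_seq q.1)/= ?undup_uniq// ?mem_undup ?map_f//.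
    by rewrite pp big1 ?addr0// => i iq; exact: p_orth.
move=> y [Sy fy xy]; apply/funext => k.
have [r' ur' r'y] := finite_support_seq fy.
have py i : p i (y i) = y i by have [z _ <-] := Sy i.
have pky i : i != k -> p k (y i) = 0.
  by move=> ik; have [z _ <-] := Sy i; rewrite p_orth// eq_sym.
rewrite xy (fsum_seq ur' r'y) p_sum.
case: (boolP (k \in r')) => [kr|kr].
  by rewrite (bigD1_seq k)//= py big1 ?addr0// => i /pky.
by rewrite (r'y _ kr) big_seq big1// => i ir; apply: pky; apply: contraNneq kr => <-.
Qed.

End DirectSumIdempotents.

Lemma direct_sum_seq (V : zmodType) (I : choiceType) (S : I -> set V) x :
  direct_sum S -> exists s : seq (I * V),
    (forall q, q \in s -> S q.1 q.2) /\ x = \sum_(q <- s) q.2.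
Proof.
move=> /(_ x)[y [[Sy fy xE] _]].
have [r ur ry] := finite_support_seq fy.
exists [seq (i, y i) | i <- r]; split; first by move=> q /mapP[i _ ->].
by rewrite big_map xE (fsum_seq ur ry).
Qed.

Section Triangular.
Variables (K : comPzRingType) (I J : choiceType).
Variables (U : weialg K I) (T : weialg K J) (M : ubimod U T).

(* The triple (t, m, u) stands for the matrix [t 0; m u]. *)
Definition tri_sort : lmodType K := (T * M * U)%type.

Definition tri_mul (x y : tri_sort) : tri_sort :=
  let: (t, m, u) := x in let: (t', m', u') := y in
  (t ** t', ract m t' + lact u m', u ** u').

Lemma tri_mulA x y z : tri_mul x (tri_mul y z) = tri_mul (tri_mul x y) z.
Proof.
case: x y z => [[t m] u] [[t1 m1] u1] [[t2 m2] u2] /=.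
by rewrite !amulA ractA lactA lactDr ractDl lractA addrA.
Qed.

Lemma tri_mulDl x y z : tri_mul (x + y) z = tri_mul x z + tri_mul y z.
Proof.
case: x y z => [[t m] u] [[t1 m1] u1] [[t2 m2] u2] /=.
by congr (_, _, _); rewrite ?amulDl ?ractDl ?lactDl// addrACA.
Qed.

Lemma tri_mulDr x y z : tri_mul x (y + z) = tri_mul x y + tri_mul x z.
Proof.
case: x y z => [[t m] u] [[t1 m1] u1] [[t2 m2] u2] /=.
by congr (_, _, _); rewrite ?amulDr ?ractDr ?lactDr// addrACA.
Qed.

Lemma tri_scaleAl k x y : k *: tri_mul x y = tri_mul (k *: x) y.
Proof.
case: x y => [[t m] u] [[t1 m1] u1] /=.
by congr (_, _, _); rewrite ?ascaleAl// ractZl lactZl scalerDr.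
Qed.

Lemma tri_scaleAr k x y : k *: tri_mul x y = tri_mul x (k *: y).
Proof.
case: x y => [[t m] u] [[t1 m1] u1] /=.
by congr (_, _, _); rewrite ?ascaleAr// ractZr lactZr scalerDr.
Qed.

Definition tri_nualg : nualg K :=
  NuAlg tri_mulA tri_mulDl tri_mulDr tri_scaleAl tri_scaleAr.

(* inl i is the index (i, 1) and inr j the index (j, 2). *)
Definition tri_idem (r : I + J) : tri_nualg :=
  match r with
  | inl i => (0, 0, idem U i)
  | inr j => (idem T j, 0, 0)
  end.

Let amul0r (R : nualg K) (x : R) : 0 ** x = 0.
Proof. by apply: (@addrI _ (0 ** x)); rewrite -amulDl !addr0. Qed.
Let amulr0 (R : nualg K) (x : R) : x ** 0 = 0.
Proof. by apply: (@addrI _ (x ** 0)); rewrite -amulDr !addr0. Qed.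
Let lact0r (m : M) : lact (0 : U) m = 0.
Proof. by apply: (@addrI _ (lact (0 : U) m)); rewrite -lactDl !addr0. Qed.
Let lactr0 (u : U) : lact u (0 : M) = 0.
Proof. by apply: (@addrI _ (lact u (0 : M))); rewrite -lactDr !addr0. Qed.
Let ract0r (t : T) : ract (0 : M) t = 0.
Proof. by apply: (@addrI _ (ract (0 : M) t)); rewrite -ractDl !addr0. Qed.
Let ractr0 (m : M) : ract m (0 : T) = 0.
Proof. by apply: (@addrI _ (ract m (0 : T))); rewrite -ractDr !addr0. Qed.

Let sum0 := (amul0r, amulr0, lact0r, lactr0, ract0r, ractr0, addr0, add0r).

Lemma tri_idem_idem r : tri_idem r ** tri_idem r = tri_idem r.
Proof. by case: r => [i|j] /=; rewrite !sum0 idem_idem. Qed.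

Lemma tri_idem_orth r s : r != s -> tri_idem r ** tri_idem s = 0.
Proof.
by case: r s => [i|j] [i'|j'] //= rs; rewrite !sum0// idem_orth.
Qed.

Let spanned (p : I + J -> tri_sort -> tri_sort) (x : tri_sort) :=
  exists s : seq ((I + J) * tri_sort), x = \sum_(q <- s) p q.1 q.2.

Let spannedD p x y : spanned p x -> spanned p y -> spanned p (x + y).
Proof. by move=> [s ->] [s' ->]; exists (s ++ s'); rewrite big_cat. Qed.

Let spanned_sum p (A : eqType) (s : seq A) (F : A -> tri_sort) :
  (forall a, a \in s -> spanned p (F a)) -> spanned p (\sum_(a <- s) F a).
Proof.
elim: s => [_|a s IH sF]; first by exists [::]; rewrite !big_nil.
rewrite big_cons; apply: spannedD; first by apply: sF; rewrite mem_head.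
by apply: IH => b bs; apply: sF; rewrite in_cons bs orbT.
Qed.

Let spanned1 p r x : spanned p (p r x).
Proof. by exists [:: (r, x)]; rewrite big_seq1. Qed.

Let injT_sum A (s : seq A) (F : A -> T) :
  (\sum_(a <- s) F a, 0, 0) = \sum_(a <- s) (F a, 0, 0) :> tri_sort.
Proof.
elim: s => [|a s IH]; first by rewrite !big_nil.
by rewrite !big_cons -IH; congr (_, _, _); rewrite addr0.
Qed.

Let injM_sum A (s : seq A) (F : A -> M) :
  (0, \sum_(a <- s) F a, 0) = \sum_(a <- s) (0, F a, 0) :> tri_sort.
Proof.
elim: s => [|a s IH]; first by rewrite !big_nil.
by rewrite !big_cons -IH; congr (_, _, _); rewrite addr0.
Qed.

Let injU_sum A (s : seq A) (F : A -> U) :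
  (0, 0, \sum_(a <- s) F a) = \sum_(a <- s) (0, 0, F a) :> tri_sort.
Proof.
elim: s => [|a s IH]; first by rewrite !big_nil.
by rewrite !big_cons -IH; congr (_, _, _); rewrite addr0.
Qed.

Let decomp (t : T) (m : M) (u : U) :
  (t, m, u) = (t, 0, 0) + (0, m, 0) + (0, 0, u) :> tri_sort.
Proof.
have et : t = t + 0 + 0 by rewrite !addr0.
have em : m = 0 + m + 0 by rewrite addr0 add0r.
have eu : u = 0 + 0 + u by rewrite !add0r.
exact: (congr2 pair (congr2 pair et em) eu).
Qed.

Lemma tri_idem_sumr : direct_sum (fun r => range (fun x => tri_idem r ** x)).
Proof.
apply: direct_sum_span => [r x y|r x|r s x rs|[[t m] u]].
- exact: amulDr.
- by rewrite amulA tri_idem_idem.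
- by rewrite amulA tri_idem_orth// amul0r.
pose p (r : I + J) (x : tri_sort) : tri_sort := tri_idem r ** (x : tri_nualg).
change (spanned p (t, m, u)); rewrite decomp; apply: spannedD; first apply: spannedD.
- have [s [sS ->]] := direct_sum_seq t (idem_sumr T).
  rewrite injT_sum; apply: (spanned_sum (p := p)) => -[j _] /sS/= [y _ <-].
  rewrite (_ : (_, _, _) = p (inr j) (y, 0, 0));
    first exact: spanned1.
  by rewrite /p /= !sum0.
- have [s [_ ->]] := @unitary_left _ _ _ M m Logic.I.
  rewrite injM_sum; apply: (spanned_sum (p := p)) => -[v n] _ /=.
  have [s' [sS ->]] := direct_sum_seq v (idem_sumr U).
  rewrite (morphD_sum s' snd (f := fun v : U => lact v n) (fun a b => lactDl a b n)).
  rewrite injM_sum; apply: (spanned_sum (p := p)) => -[i _] /sS/= [y _ <-].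
  rewrite (_ : (_, _, _) = p (inl i) (0, lact y n, 0));
    first exact: spanned1.
  by rewrite /p /= !sum0 lactA.
- have [s [sS ->]] := direct_sum_seq u (idem_sumr U).
  rewrite injU_sum; apply: (spanned_sum (p := p)) => -[i _] /sS/= [y _ <-].
  rewrite (_ : (_, _, _) = p (inl i) (0, 0, y));
    first exact: spanned1.
  by rewrite /p /= !sum0.
Qed.

Lemma tri_idem_suml : direct_sum (fun r => range (fun x => x ** tri_idem r)).
Proof.
apply: (@direct_sum_span _ _ (fun r x => x ** tri_idem r))
  => [r x y|r x|r s x rs|[[t m] u]].
- exact: amulDl.
- by rewrite -amulA tri_idem_idem.
- by rewrite -amulA tri_idem_orth ?amulr0// eq_sym.
pose p (r : I + J) (x : tri_sort) : tri_sort := (x : tri_nualg) ** tri_idem r.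
change (spanned p (t, m, u)); rewrite decomp; apply: spannedD; first apply: spannedD.
- have [s [sS ->]] := direct_sum_seq t (idem_suml T).
  rewrite injT_sum; apply: (spanned_sum (p := p)) => -[j _] /sS/= [y _ <-].
  rewrite (_ : (_, _, _) = p (inr j) (y, 0, 0));
    first exact: spanned1.
  by rewrite /p /= !sum0.
- have [s [_ ->]] := @unitary_right _ _ _ M m Logic.I.
  rewrite injM_sum; apply: (spanned_sum (p := p)) => -[v n] _ /=.
  have [s' [sS ->]] := direct_sum_seq v (idem_suml T).
  rewrite (morphD_sum s' snd (f := fun v : T => ract n v) (ractDr n)).
  rewrite injM_sum; apply: (spanned_sum (p := p)) => -[j _] /sS/= [y _ <-].
  rewrite (_ : (_, _, _) = p (inr j) (0, ract n y, 0));
    first exact: spanned1.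
  by rewrite /p /= !sum0 ractA.
- have [s [sS ->]] := direct_sum_seq u (idem_suml U).
  rewrite injU_sum; apply: (spanned_sum (p := p)) => -[i _] /sS/= [y _ <-].
  rewrite (_ : (_, _, _) = p (inl i) (0, 0, y));
    first exact: spanned1.
  by rewrite /p /= !sum0.
Qed.

Definition triangular : weialg K (I + J)%type :=
  WeiAlg tri_idem_idem tri_idem_orth tri_idem_sumr tri_idem_suml.

End Triangular.

(* Main.v *)
(** The columns and rows of [L = [T 0; M U]] are the columns and rows of [U] and
[T] with [M f_j], resp. [e_i M], adjoined, so the supports of [L] are disjoint
unions of those of [U], [T] and of the pieces of [M].  If [Re_i] always has
finite support, a unitary module generated by [x_1, ..., x_n] is supported on
the finitely many [Re_i] with [i] occurring in a decomposition
[x_a = \sum_i e_i y_i].  Conversely, a unitary module with finite support is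
generated by its finitely many pieces [e_k N], each finitely generated over [K]
when it has finite length.  Local boundedness is then automatic: scalars act by
endomorphisms, so a piece of finite length over [K] has finite length over any
endomorphism ring. *)
Require Import Defs.
From mathcomp Require Import all_boot all_order all_algebra.
From mathcomp Require Import boolp classical_sets functions cardinality.

Set Implicit Arguments.
Unset Strict Implicit.
Unset Printing Implicit Defensive.

Import GRing.Theory.
Local Open Scope classical_set_scope.
Local Open Scope ring_scope.

(** * Modules over algebras without unity *)

Section LeftModules.
Variables (K : comPzRingType) (R : nualg K) (V : leftmod R).

Lemma act0 (r : R) : act r (0 : V) = 0.
Proof. by apply: (@addrI _ (act r (0 : V))); rewrite -actDr !addr0. Qed.

Lemma act0l (x : V) : act (0 : R) x = 0.
Proof. by apply: (@addrI _ (act (0 : R) x)); rewrite -actDl !addr0. Qed.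

Lemma actB (r : R) (x y : V) : act r (x - y) = act r x - act r y.
Proof. by apply: (@addIr _ (act r y)); rewrite -actDr !subrK. Qed.

Lemma act_sumr (A : Type) (s : seq A) (F : A -> V) (r : R) :
  act r (\sum_(a <- s) F a) = \sum_(a <- s) act r (F a).
Proof. by apply: (morphD_sum _ _ (f := fun x : V => act r x)); exact: actDr. Qed.

Lemma act_suml (A : Type) (s : seq A) (F : A -> R) (x : V) :
  act (\sum_(a <- s) F a) x = \sum_(a <- s) act (F a) x.
Proof. by apply: (morphD_sum _ _ (f := fun r : R => act r x)) => r r'; exact: actDl. Qed.

Lemma submoduleD (N : set V) x y : submodule N -> N x -> N y -> N (x + y).
Proof.
by case=> N0 NB _ Nx Ny; rewrite -(opprK y) -(sub0r y); apply: (NB) => //; exact: NB.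
Qed.

Lemma submodule_sum (N : set V) (A : eqType) (s : seq A) (F : A -> V) :
  submodule N -> (forall a, a \in s -> N (F a)) -> N (\sum_(a <- s) F a).
Proof.
move=> sN NF; rewrite big_seq; elim/big_ind: _ => //; first by case: sN.
by move=> x y; exact: submoduleD.
Qed.

End LeftModules.

Section Nualg.
Variables (K : comPzRingType) (R : nualg K).

Lemma amul0 (x : R) : 0 ** x = 0.
Proof. exact: (act0l (V := regular R)). Qed.

Lemma amulr0 (x : R) : x ** 0 = 0.
Proof. exact: (act0 (regular R)). Qed.

End Nualg.

Section BimodZero.
Variables (K : comPzRingType) (U T : nualg K) (M : bimod U T).

Lemma lact0 (m : M) : lact (0 : U) m = 0.
Proof. exact: (act0l (V := left_of M)). Qed.

Lemma lactr0 (u : U) : lact u (0 : M) = 0.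
Proof. exact: (act0 (left_of M)). Qed.

Lemma ract0 (t : T) : ract (0 : M) t = 0.
Proof. exact: (act0 (right_of M)). Qed.

Lemma ractr0 (m : M) : ract m (0 : T) = 0.
Proof. exact: (act0l (V := right_of M)). Qed.

End BimodZero.

Definition op0E := (amul0, amulr0, lact0, lactr0, ract0, ractr0, addr0, add0r).

(** * Finite length *)

(** [F] turns a strict chain in [N] into a strict chain of the same length in [N'], so a bound for
    [N'] also bounds [N]. The two sides may use different notions of submodule. *)
Lemma finite_length_map (V W : Type) (sub : set V -> Prop) (sub' : set W -> Prop)
    (N : set V) (N' : set W) (F : set V -> set W) :
  (forall A, sub A -> A `<=` N -> sub' (F A) /\ F A `<=` N') ->
  (forall A B, B `<=` N -> A `<` B -> F A `<` F B) ->
  finite_length sub' N' -> finite_length sub N.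
Proof.
move=> Fsub Fproper [b bP]; exists b => n c cN c_lt.
apply: (bP n (F \o c)) => i i_le /=; first by have [] := cN i i_le; exact: Fsub.
by apply: Fproper; [have [] := cN i.+1 i_le | exact: c_lt].
Qed.

(** Chains in [N] are pulled back along [f]; they stay strict because every point of [N] is hit from
    [A]. *)
Lemma kfinite_length_embed (K : comPzRingType) (V W : lmodType K) (f : V -> W)
    (A : set V) (N : set W) :
  (forall (k : K) x y, f (k *: x + y) = k *: f x + f y) -> injective f ->
  N `<=` f @` A -> kfinite_length A -> kfinite_length N.
Proof.
move=> fL f_inj NA; apply: (finite_length_map (F := fun B => f @^-1` B)).
  have f0 : f 0 = 0.
    by apply: (@addIr _ (1 *: f 0)); rewrite addrC -fL scaler0 addr0 scale1r add0r.
  move=> B [B0 BD] BN; split; first split=> /=; first by rewrite /preimage/= f0.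
    by move=> k x y Bx By; rewrite /preimage/= fL; exact: BD.
  by move=> x /BN/NA[y Ay] /f_inj <-.
move=> B C CN [BC nCB]; split; first by move=> x; exact: BC.
move=> CB; apply: nCB => y Cy.
by have [x _ xy] := NA _ (CN _ Cy); rewrite -xy; apply: CB; rewrite /preimage/= xy.
Qed.

Lemma kfinite_length_generated (K : comPzRingType) (V : lmodType K) (A : set V) :
  ksubmodule A -> kfinite_length A ->
  exists s : seq V, (forall x, x \in s -> A x) /\
    (forall B, ksubmodule B -> (forall x, x \in s -> B x) -> A `<=` B).
Proof.
move=> kA [b bP]; apply: contrapT => not_gen.
pose gen (s : seq V) : set V :=
  [set x | forall B, ksubmodule B -> (forall y, y \in s -> B y) -> B x].
have gen_sub s : ksubmodule (gen s).
  split=> [B [] //|k x y gx gy B kB sB].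
  by have [_] := kB; apply; [exact: gx | exact: gy].
(* The guard on [s] makes the claim total in [s], so that choice applies; for a list not inside [A]
   any value serves. *)
have /choice[new newP] : forall s : seq V, exists x,
    (forall y, y \in s -> A y) -> A x /\ ~ gen s x.
  move=> s; apply: contrapT => no_new; apply: not_gen; exists s.
  split=> [x xs|B kB sB x Ax].
    apply: contrapT => nAx; apply: no_new; exists 0 => sA.
    by case: nAx; exact: sA.
  apply: contrapT => nBx; apply: no_new; exists x => _.
  by split=> // gx; apply: nBx; exact: gx.
(* Adding a generator outside the span at each step gives arbitrarily long chains. *)
pose s n := iter n (fun t => new t :: t) [::].
have sA n : forall x, x \in s n -> A x.
  elim: n => [//|n IH] x /=; rewrite inE => /predU1P[->|/IH //].
  by have [] := newP _ IH.
(* The spans of [s 0], ..., [s b.+1] form a chain with [b.+1] strict steps. *)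
have : (b.+1 <= b)%N; last by rewrite ltnn.
apply: (bP _ (gen \o s)) => n _ /=; first by split=> // x gx; apply: gx kA (@sA n).
split=> [x gx B kB sB|gS].
  by apply: gx => // y ys; apply: sB; rewrite inE ys orbT.
have [_ []] := newP _ (@sA n); apply: gS => B kB sB.
by apply: sB; rewrite inE eqxx.
Qed.

(** * Support and finite generation *)

Section Support.
Variables (K : comPzRingType) (I : choiceType) (R : weialg K I) (V : leftmod R).
Implicit Type N : set V.

(** [N 0] rules out an empty cut, so a cut other than [[set 0]] has a nonzero element. *)
Lemma suppP N k : N 0 -> supp N k <-> exists2 x, N x & act (idem R k) x <> 0.
Proof.
move=> N0; split=> [cutN|[x Nx kx] cutN]; last first.
  by apply: kx; rewrite -[_ = 0]/([set 0] _) -cutN; exists x.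
apply: contrapT => no_x; apply: cutN; apply/seteqP; split=> [_ [x Nx <-]|_ ->].
  by apply: contrapT => kx; apply: no_x; exists x.
by exists 0; rewrite ?act0.
Qed.

Lemma act_nsupp N k x : N 0 -> ~ supp N k -> N x -> act (idem R k) x = 0.
Proof. by move=> N0 nk Nx; apply: contrapT => kx; apply/nk/suppP => //; exists x. Qed.

Lemma unitary_idem_sum N x : submodule N -> unitary N -> N x ->
  exists s : seq (I * V), (forall q, q \in s -> N q.2) /\
    x = \sum_(q <- s) act (idem R q.1) q.2.
Proof.
move=> [_ _ Nact] uN /uN[s [sN ->]]; elim: s sN => [_|p s IH sN].
  by exists [::]; split=> //; rewrite !big_nil.
have [q qs|t [tN tE]] := IH; first by apply: sN; rewrite inE qs orbT.
have [r [rR rE]] := direct_sum_seq p.1 (idem_sumr R).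
(* Each [q.2] has the form $e_i y$ with $i$ = [q.1], so $e_i$ fixes [act q.2 p.2]. *)
exists ([seq (q.1, act q.2 p.2) | q <- r] ++ t); split=> [q|].
  rewrite mem_cat => /orP[/mapP[q' _ ->]/=|/tN //].
  by apply: Nact; apply: sN; rewrite mem_head.
rewrite big_cons big_cat tE big_map {1}rE act_suml; congr (_ + _).
by apply: eq_big_seq => q /rR[y _ <-]; rewrite -actA amulA idem_idem.
Qed.

End Support.

Section LeftProj.
Variables (K : comPzRingType) (I : choiceType) (R : weialg K I).

Lemma left_proj0 i : left_proj R i 0.
Proof. by exists 0 => //; rewrite amul0. Qed.

(** Applied to [weialg_op R], the same criterion describes the support of the right module
    $e_iR$. *)
Lemma left_proj_suppP i k :
  supp (left_proj R i) k <-> exists x : R, idem R k ** x ** idem R i <> 0.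
Proof.
apply: (iff_trans (suppP k (left_proj0 i))).
split=> [[_ [x _ <-]]|[x kxi]]; first by exists x; rewrite -amulA.
by exists (x ** idem R i); [exists x | rewrite /= amulA].
Qed.

End LeftProj.

Section FiniteGeneration.
Variables (K : comPzRingType) (I : choiceType) (R : weialg K I) (V : leftmod R).
Implicit Type N : set V.

Lemma fg_unitary_supp N : (forall i, finite_set (supp (left_proj R i))) ->
  fg_unitary_module N -> finite_set (supp N).
Proof.
move=> sR [sN uN [s [sN' gen]]]; have [N0 _ Nact] := sN.
have /choice[S SP] : forall x, exists A : set I, N x -> finite_set A /\
    forall k, ~ A k -> forall r, act (idem R k ** r) x = 0.
  move=> x; have [Nx|] := pselect (N x); last by exists set0.
  have [t [_ xE]] := unitary_idem_sum sN uN Nx.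
  (* With $x=\sum_i e_iy_i$, one has $e_krx=\sum_i(e_kre_i)y_i$, which vanishes unless $k$ lies in
     the support of some $Re_i$ occurring here. *)
  exists (\bigcup_(i in [set` map fst t]) supp (left_proj R i)) => _.
  split=> [|k nk r]; first exact: bigcup_finite.
  rewrite xE act_sumr big_seq big1// => q qt; rewrite -actA.
  have [->|kq] := eqVneq (idem R k ** r ** idem R q.1) 0; first by rewrite act0l.
  case: nk; exists q.1 => /=; first exact: map_f.
  by apply/left_proj_suppP; exists r; exact/eqP.
(* Quantifying over [r] makes [N'] below a submodule. *)
pose F := \bigcup_(x in [set` s]) S x.
pose N' : set V := [set x | forall k, ~ F k -> forall r, act (idem R k ** r) x = 0].
have subN' : submodule N'.
  split=> [k _ r|x y N'x N'y k nk r|r x N'x k nk r'].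
  - exact: act0.
  - by rewrite actB N'x// N'y// subrr.
  - by rewrite -actA -amulA N'x.
apply: (sub_finite_set (B := F)); last first.
  by apply: bigcup_finite => // x /sN'/SP[].
move=> k /(suppP _ N0)[x Nx kx]; apply: contrapT => nk; apply: kx.
(* Writing $e_k=e_ke_k$ gives the form $e_kr$ with $r=e_k$, there being no unit to take for $r$. *)
rewrite -idem_idem; apply: (gen N') nk _ => // {Nx}y ys j nj r.
by have [_] := SP y (sN' y ys); apply => Sj; apply: nj; exists y.
Qed.

(** Components $e_kx$ outside the support vanish, so the generators chosen for the finitely many
    remaining [k] generate all of [N]. *)
Lemma finite_supp_fg N : submodule N -> unitary N -> finite_set (supp N) ->
  (forall k, exists s : seq V, (forall x, x \in s -> N x) /\
     forall N', submodule N' -> (forall x, x \in s -> N' x) -> cut k N `<=` N') ->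
  fg_unitary_module N.
Proof.
move=> sN uN /finite_seqP[r suppE] /choice[gen genP]; split=> //.
exists (flatten [seq gen k | k <- r]); split=> [x /flatten_mapP[k _ xk]|N' sN' genN'].
  by have [gN _] := genP k; exact: gN.
move=> _ /(unitary_idem_sum sN uN)[s [sNs ->]]; apply: submodule_sum => // q /sNs Nq.
have [kr|kr] := pselect (supp N q.1); last first.
  by rewrite (act_nsupp _ kr Nq); [case: sN' | case: sN].
have [_ gN'] := genP q.1; apply: (gN' N' sN'); last by exists q.2.
move=> x xq; apply: genN'; apply/flatten_mapP; exists q.1 => //.
by move: kr; rewrite suppE.
Qed.

End FiniteGeneration.

(** * Local endofiniteness *)

Section Endofinite.
Variables (K : comPzRingType) (I : choiceType).

(* Multiplication by a scalar is an endomorphism of [R e_i], so submodules over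
   the endomorphism ring are in particular [K]-submodules. *)
Lemma left_proj_endofinite (R : weialg K I) i :
  (forall k, kfinite_length (range (fun x : R => idem R k ** x ** idem R i))) ->
  endofinite (left_proj R i).
Proof.
move=> finR k; apply: (finite_length_map (F := id)) (finR k) => [A [A0 AB AN Aend] Ak|A B _ //].
split; last by move=> _ /Ak[_ [x _ <-] <-]; exists x => //=; rewrite amulA.
split=> // c x y Ax Ay.
have AyN : A (0 - y) := AB _ _ A0 Ay.
rewrite -(opprK y) -(sub0r y); apply: (AB (c *: x) (0 - y)) AyN.
apply: (Aend ( *:%R c)) Ax; split=> [_ [z _ <-]|z w _ _|r z _].
- by exists (c *: z); rewrite // -ascaleAl.
- exact: scalerDr.
- exact: ascaleAr.
Qed.

Lemma locally_endofiniteW (R : weialg K I) :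
  (forall i j, kfinite_length (range (fun x : R => idem R j ** x ** idem R i))) ->
  locally_endofinite R.
Proof.
move=> finR i; split; first exact: left_proj_endofinite.
apply: left_proj_endofinite => k.
(* The $k$-th piece of $e_iR$ is $e_iRe_k$, the same set up to bracketing. *)
apply: (kfinite_length_embed (f := id) _ _ _ (finR k i)) => // _ [x _ <-].
by exists (idem R i ** x ** idem R k); [exists x | rewrite /= amulA].
Qed.

Lemma basic_locally_bounded (R : weialg K I) :
  basic R -> support_finite R -> locally_bounded R.
Proof. by move=> [finR prR _] sR; split=> //; exact: locally_endofiniteW. Qed.

End Endofinite.

(** * Triangular algebras *)

Section TriangularAlgebra.
Variables (K : comPzRingType) (I J : choiceType).
Variables (U : weialg K I) (T : weialg K J) (M : ubimod U T).
Local Notation L := (triangular M).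

(** * Corners of the triangular algebra: finite length and primitive idempotents *)

Let injT (t : T) : tri_sort M := (t, 0, 0).
Let injM (m : M) : tri_sort M := (0, m, 0).
Let injU (u : U) : tri_sort M := (0, 0, u).

Let injT_linear (k : K) x y : injT (k *: x + y) = k *: injT x + injT y.
Proof. by congr (_, _, _); rewrite addr0; exact: esym (scaler0 _ _). Qed.

Let injM_linear (k : K) x y : injM (k *: x + y) = k *: injM x + injM y.
Proof. by congr (_, _, _); rewrite addr0; exact: esym (scaler0 _ _). Qed.

Let injU_linear (k : K) x y : injU (k *: x + y) = k *: injU x + injU y.
Proof. by congr (_, _, _); rewrite addr0; exact: esym (scaler0 _ _). Qed.

Lemma triangular_kfinite_length :
  (forall i k, kfinite_length (range (fun x : U => idem U k ** x ** idem U i))) ->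
  (forall j l, kfinite_length (range (fun x : T => idem T l ** x ** idem T j))) ->
  (forall i j, kfinite_length (e_bimod_f M i j)) ->
  forall r s, kfinite_length (range (fun x : L => idem L s ** x ** idem L r)).
Proof.
move=> finU finT finM [i|j] [k|l].
- apply: (kfinite_length_embed (f := injU) injU_linear _ _ (finU i k)) => [x y [] //|].
  move=> _ [[[t m] u] _ <-]; exists (idem U k ** u ** idem U i); first by exists u.
  by rewrite /= !op0E.
(* The upper right block is zero; [finU i i] merely supplies a set of finite length containing 0. *)
- apply: (kfinite_length_embed (f := injU) injU_linear _ _ (finU i i)) => [x y [] //|].
  move=> _ [[[t m] u] _ <-]; exists 0; first by exists 0; rewrite ?op0E.
  by rewrite /= !op0E.
- apply: (kfinite_length_embed (f := injM) injM_linear _ _ (finM k j)) => [x y [] //|].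
  move=> _ [[[t m] u] _ <-]; exists (ract (lact (idem U k) m) (idem T j)); first by exists m.
  by rewrite /= !op0E.
- apply: (kfinite_length_embed (f := injT) injT_linear _ _ (finT j l)) => [x y [] //|].
  move=> _ [[[t m] u] _ <-]; exists (idem T l ** t ** idem T j); first by exists t.
  by rewrite /= !op0E.
Qed.

(** Multiplying $x+y=0$ by $x$ on the left leaves $x^2=x$. *)
Let annihilating_idem0 (R : nualg K) (x y : R) :
  x ** x = x -> x ** y = 0 -> x + y = 0 -> x = 0.
Proof. by move=> xx xy xy0; rewrite -xx -[RHS](amulr0 x) -xy0 amulDr xy addr0. Qed.

(** The diagonal entries of the two summands are orthogonal idempotents. Where the entry of $g_r$ is
    zero both vanish; at the other, primitivity in [U] or [T] kills one. A summand with zero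
    diagonal is zero, since idempotence gives $m=mt+um$. *)
Lemma triangular_primitive r :
  (forall i, primitive_idem (idem U i)) -> (forall j, primitive_idem (idem T j)) ->
  primitive_idem (idem L r).
Proof.
move=> prU prT; split; first exact: idem_idem.
  case: r => [i|j] []; last by have [_] := prT j.
  by have [_] := prU i.
move=> [[t m] u] [[t' m'] u'] [tt mm uu] [tt' mm' uu'] [ab_t _ ab_u] [ba_t _ ba_u].
have m0 : t = 0 -> u = 0 -> m = 0.
  by move=> t0 u0; rewrite -mm t0 u0 !op0E.
have m0' : t' = 0 -> u' = 0 -> m' = 0.
  by move=> t0 u0; rewrite -mm' t0 u0 !op0E.
case: r => [i|j] [/esym e_t _ e_u].
  have t0 : t = 0 by apply: annihilating_idem0 e_t.
  have t0' : t' = 0 by apply: (annihilating_idem0 (x := t') (y := t)); rewrite // addrC.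
  have [_ _ prU'] := prU i.
  have [u0|u0] := prU' _ _ uu uu' ab_u ba_u e_u; [left|right].
    by rewrite (m0 t0 u0) t0 u0.
  by rewrite (m0' t0' u0) t0' u0.
have {}e_u := esym e_u.
have u0 : u = 0 by apply: annihilating_idem0 e_u.
have u0' : u' = 0 by apply: (annihilating_idem0 (x := u') (y := u)); rewrite // addrC.
have [_ _ prT'] := prT j.
have [t0|t0] := prT' _ _ tt tt' ab_t ba_t (esym e_t); [left|right].
  by rewrite (m0 t0 u0) t0 u0.
by rewrite (m0' t0 u0') t0 u0'.
Qed.

(** * The pieces $Mf_j$ and $e_iM$ as modules *)

Lemma bimod_f_submodule j : submodule (bimod_f M j).
Proof.
split=> [|_ _ [x _ <-] [y _ <-]|r _ [x _ <-]].
- by exists 0; rewrite ?op0E.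
- by exists (x - y) => //; exact: (actB (V := right_of M)).
- by exists (lact r x); rewrite //= lractA.
Qed.

Lemma e_bimod_submodule i : submodule (e_bimod M i).
Proof.
split=> [|_ _ [x _ <-] [y _ <-]|r _ [x _ <-]].
- by exists 0; rewrite ?op0E.
- by exists (x - y) => //; exact: (actB (V := left_of M)).
- by exists (ract x r); rewrite //= lractA.
Qed.

Lemma bimod_f_unitary j : unitary (bimod_f M j).
Proof.
move=> _ [x _ <-]; have [s [_ ->]] := @unitary_left _ _ _ M x Logic.I.
exists [seq (p.1, ract p.2 (idem T j)) | p <- s]; split=> [_ /mapP[p _ ->]|].
  by exists p.2.
rewrite big_map; apply: (etrans (act_sumr (V := right_of M) _ _ (idem T j))).
by apply: eq_bigr => p _; rewrite /= lractA.
Qed.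

Lemma e_bimod_unitary i : unitary (e_bimod M i).
Proof.
move=> _ [x _ <-]; have [s [_ ->]] := @unitary_right _ _ _ M x Logic.I.
exists [seq (p.1, lact (idem U i) p.2) | p <- s]; split=> [_ /mapP[p _ ->]|].
  by exists p.2.
rewrite big_map; apply: (etrans (act_sumr (V := left_of M) _ _ (idem U i))).
by apply: eq_bigr => p _; rewrite /= lractA.
Qed.

Let e_bimod_f_ksubmodule i j : ksubmodule (e_bimod_f M i j).
Proof.
split=> [|k _ _ [x _ <-] [y _ <-]]; first by exists 0; rewrite ?op0E.
by exists (k *: x + y); rewrite // lactDr lactZr ractDl ractZl.
Qed.

(** Finitely many [K]-generators of $e_iMf_j$ also generate it over [U], because scalars act on it
    through [U]. *)
Lemma bimod_f_fg j : (forall i, kfinite_length (e_bimod_f M i j)) ->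
  finite_set (supp (R := U) (bimod_f M j)) -> fg_unitary_module (bimod_f M j).
Proof.
move=> finM sM; have sub := bimod_f_submodule j.
apply: (finite_supp_fg sub (@bimod_f_unitary j) sM) => i.
have [s [sM' gen]] := kfinite_length_generated (e_bimod_f_ksubmodule i j) (finM i).
exists s; split=> [x /sM'[y _ <-]|N' sN' genN' _ [_ [x _ <-] <-]].
  by exists (lact (idem U i) y).
(* Intersecting the [U]-submodule [N'] with $e_iMf_j$ yields a [K]-submodule, to which [gen]
   applies. *)
suff: (e_bimod_f M i j `&` N') (lact (idem U i) (ract x (idem T j))) by case.
apply: gen => [|y ys|]; last by exists x; rewrite // lractA.
  have [N'0 _ N'act] := sN'; have [B0 BD] := e_bimod_f_ksubmodule i j.
  split=> // k y z [By N'y] [Bz N'z]; split; first exact: BD.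
  (* On $e_iMf_j$ the scalar $k$ acts as the element $ke_i$ of [U]. *)
  have -> : k *: y = lact (k *: idem U i) y.
    have [w _ <-] := By.
    by rewrite lactZl -lractA -lactA idem_idem.
  by apply: (submoduleD (V := left_of M)) => //; exact: N'act.
by split; [exact: sM' | exact: genN'].
Qed.

Lemma e_bimod_fg i : (forall j, kfinite_length (e_bimod_f M i j)) ->
  finite_set (supp (R := weialg_op T) (e_bimod M i)) ->
  fg_unitary_module (e_bimod M i).
Proof.
move=> finM sM; have sub := e_bimod_submodule i.
apply: (finite_supp_fg (R := weialg_op T) sub (@e_bimod_unitary i) sM) => j.
have [s [sM' gen]] := kfinite_length_generated (e_bimod_f_ksubmodule i j) (finM j).
exists s; split=> [x /sM'[y _ <-]|N' sN' genN' _ [_ [x _ <-] <-]].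
  by exists (ract y (idem T j)); rewrite // lractA.
suff: (e_bimod_f M i j `&` N') (ract (lact (idem U i) x) (idem T j)) by case.
apply: gen => [|y ys|]; last by exists x.
  have [N'0 _ N'act] := sN'; have [B0 BD] := e_bimod_f_ksubmodule i j.
  split=> // k y z [By N'y] [Bz N'z]; split; first exact: BD.
  (* On the right, $k$ acts as the element $kf_j$ of [T]. *)
  have -> : k *: y = ract y (k *: idem T j).
    have [w _ <-] := By.
    by rewrite ractZr -ractA idem_idem.
  by apply: (submoduleD (V := right_of M)) => //; exact: N'act.
by split; [exact: sM' | exact: genN'].
Qed.

Lemma bimod_f_suppP j k : supp (R := U) (bimod_f M j) k <->
  exists m : M, ract (lact (idem U k) m) (idem T j) <> 0.
Proof.
have [M0 _ _] := bimod_f_submodule j.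
apply: (iff_trans (suppP (R := U) k M0)).
split=> [[_ [m _ <-]]|[m nz]]; first by exists m; rewrite lractA.
by exists (ract m (idem T j)); [exists m | rewrite /= -lractA].
Qed.

Lemma e_bimod_suppP i l : supp (R := weialg_op T) (e_bimod M i) l <->
  exists m : M, ract (lact (idem U i) m) (idem T l) <> 0.
Proof.
have [M0 _ _] := e_bimod_submodule i.
apply: (iff_trans (suppP (R := weialg_op T) l M0)).
split=> [[_ [m _ <-]]|[m nz]]; first by exists m.
by exists (lact (idem U i) m); first by exists m.
Qed.

(** * Supports of the columns and rows of the triangular algebra *)

Lemma triangular_supp_left_U i :
  supp (left_proj L (inl i)) = inl @` supp (left_proj U i).
Proof.
apply/seteqP; split=> [[k|l]|_ [k + <-]].
- move=> /left_proj_suppP[[[t m] u]]; rewrite /= !op0E => nz.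
  exists k => //; apply/left_proj_suppP; exists u => /= nz0.
  by apply: nz; rewrite nz0.
- by move=> /left_proj_suppP[[[t m] u]]; rewrite /= !op0E.
- move=> /left_proj_suppP[u nz]; apply/left_proj_suppP; exists (injU u).
  by rewrite /= !op0E => -[].
Qed.

(** The elements of $\Lambda g_{(j,2)}$ have entries $tf_j$ and $mf_j$, the latter tested by the
    idempotents of [U]. *)
Lemma triangular_supp_left_T j : supp (left_proj L (inr j)) =
  inl @` supp (R := U) (bimod_f M j) `|` inr @` supp (left_proj T j).
Proof.
apply/seteqP; split=> [[k|l]|_ [[k + <-]|[l + <-]]].
- move=> /left_proj_suppP[[[t m] u]]; rewrite /= !op0E => nz; left.
  exists k => //; apply/bimod_f_suppP; exists m => /= nz0.
  by apply: nz; rewrite nz0.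
- move=> /left_proj_suppP[[[t m] u]]; rewrite /= !op0E => nz; right.
  exists l => //; apply/left_proj_suppP; exists t => /= nz0.
  by apply: nz; rewrite nz0.
- move=> /bimod_f_suppP[m nz]; apply/left_proj_suppP; exists (injM m).
  by rewrite /= !op0E => -[].
- move=> /left_proj_suppP[t nz]; apply/left_proj_suppP; exists (injT t).
  by rewrite /= !op0E => -[].
Qed.

(** The elements of $g_{(i,1)}\Lambda$ have entries $e_im$ and $e_iu$, the former tested by the
    idempotents of [T]. *)
Lemma triangular_supp_right_U i : supp (left_proj (weialg_op L) (inl i)) =
  inl @` supp (left_proj (weialg_op U) i) `|`
  inr @` supp (R := weialg_op T) (e_bimod M i).
Proof.
apply/seteqP; split=> [[k|l]|_ [[k + <-]|[l + <-]]].
- move=> /left_proj_suppP[[[t m] u]]; rewrite /= !op0E => nz; left.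
  exists k => //; apply/left_proj_suppP; exists u => /= nz0.
  by apply: nz; rewrite nz0.
- move=> /left_proj_suppP[[[t m] u]]; rewrite /= !op0E => nz; right.
  exists l => //; apply/e_bimod_suppP; exists m => nz0.
  by apply: nz; rewrite -lractA nz0.
- move=> /left_proj_suppP[u nz]; apply/left_proj_suppP; exists (injU u).
  by rewrite /= !op0E => -[].
- move=> /e_bimod_suppP[m nz]; apply/left_proj_suppP; exists (injM m).
  by rewrite /= !op0E -lractA => -[].
Qed.

Lemma triangular_supp_right_T j : supp (left_proj (weialg_op L) (inr j)) =
  inr @` supp (left_proj (weialg_op T) j).
Proof.
apply/seteqP; split=> [[k|l]|_ [l + <-]].
- by move=> /left_proj_suppP[[[t m] u]]; rewrite /= !op0E.
- move=> /left_proj_suppP[[[t m] u]]; rewrite /= !op0E => nz.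
  exists l => //; apply/left_proj_suppP; exists t => /= nz0.
  by apply: nz; rewrite nz0.
- move=> /left_proj_suppP[t nz]; apply/left_proj_suppP; exists (injT t).
  by rewrite /= !op0E => -[].
Qed.

Lemma triangular_support_finiteP : support_finite L <->
  [/\ support_finite U, support_finite T,
      forall j, finite_set (supp (R := U) (bimod_f M j))
    & forall i, finite_set (supp (R := weialg_op T) (e_bimod M i))].
Proof.
(* Injectivity lets finiteness pass back from the copies of $I$ and $J$ inside the disjoint
   union. *)
have fin_image (I' I'' : choiceType) (f : I' -> I'') (A : set I') :
    injective f -> finite_set (f @` A) <-> finite_set A.
  move=> f_inj; split=> [fA|]; last exact: finite_image.
  apply: sub_finite_set (finite_preimage (f := f) _ fA).
    by move=> x Ax; exists x.
  by move=> x y _ _ /f_inj.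
have fin_inl (A : set I) : finite_set (inl @` A : set (I + J)) <-> finite_set A.
  by apply: fin_image => x y [].
have fin_inr (A : set J) : finite_set (inr @` A : set (I + J)) <-> finite_set A.
  by apply: fin_image => x y [].
split=> [sL|[sU sT sM eM] [i|j]].
- split=> [i|j|j|i].
  + have [] := sL (inl i).
    rewrite triangular_supp_left_U triangular_supp_right_U finite_setU.
    by move=> /fin_inl ? [/fin_inl ? _].
  + have [] := sL (inr j).
    rewrite triangular_supp_left_T triangular_supp_right_T finite_setU.
    by move=> [_ /fin_inr ?] /fin_inr ?.
  + have [+ _] := sL (inr j).
    by rewrite triangular_supp_left_T finite_setU => -[/fin_inl].
  + have [_] := sL (inl i).
    by rewrite triangular_supp_right_U finite_setU => -[_ /fin_inr].
- rewrite triangular_supp_left_U triangular_supp_right_U finite_setU.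
  by have [/fin_inl ? /fin_inl ?] := sU i; have /fin_inr := eM i.
- rewrite triangular_supp_left_T triangular_supp_right_T finite_setU.
  by have [/fin_inr ? /fin_inr ?] := sT j; have /fin_inl := sM j.
Qed.

End TriangularAlgebra.

Theorem proposition4p9 (K : comPzRingType) (I J : choiceType)
    (I_nonempty : inhabited I) (J_nonempty : inhabited J)
    (U : weialg K I) (T : weialg K J) (M : ubimod U T)
    (U_basic : basic U) (T_basic : basic T)
    (M_length : forall (i : I) (j : J), kfinite_length (e_bimod_f M i j)) :
  let L := triangular M in
  let a := support_finite L in
  let b := [/\ support_finite U, support_finite T,
      forall j : J, fg_unitary_module (bimod_f M j)
    & forall i : I, fg_unitary_module (e_bimod M i)] in
  let c := [/\ support_finite U, support_finite T,
      forall j : J, finite_set (supp (R := U) (bimod_f M j))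
    & forall i : I, finite_set (supp (R := weialg_op T) (e_bimod M i))] in
  ((a <-> b) /\ (b <-> c)) /\
  (a \/ b \/ c -> [/\ locally_bounded U, locally_bounded T & locally_bounded L]).
Proof.
move=> L a b c; have ac : a <-> c by exact: triangular_support_finiteP.
have bc : b <-> c.
  split=> -[sU sT sM eM]; split=> // [j|i].
  (* From (b) to (c), finite supports of the $Ue_i$ and the $f_jT$ suffice; the converse uses the
     finite lengths of the $e_iMf_j$. *)
  - by apply: fg_unitary_supp => // i; have [] := sU i.
  - by apply: (fg_unitary_supp (R := weialg_op T)) => // j; have [] := sT j.
  - exact: bimod_f_fg.
  - exact: e_bimod_fg.
split; first by split=> //; apply: (iff_trans ac); apply: iff_sym.
move=> abc; have {abc} hc : c by case: abc => [/ac|[/bc|]].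
have [sU sT _ _] := hc; have [finU prU _] := U_basic; have [finT prT _] := T_basic.
split; [exact: basic_locally_bounded | exact: basic_locally_bounded |].
(* For $\Lambda$, primitivity, support finiteness and endofiniteness are established in turn. *)
split; first by move=> r; exact: triangular_primitive.
  by apply/ac.
by apply: locally_endofiniteW; exact: triangular_kfinite_length.
Qed.
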